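(* Let $\mathbb{F}_q$ be a finite field, let $m>1$ and $n\geq 3$ be integers with $n\geq m-1$, and let $\sigma_1$ and $\sigma_2$ be any two distinct generators of $\mathrm{Gal}(\mathbb{F}_{q^n}/\mathbb{F}_q)$. Let $a_1,a_2\in\mathbb{F}_{q^n}\setminus\mathbb{F}_q$ (with $a_i$ taken as the constant associated with $\sigma_i$, $i=1,2$). Then $a_1$ and $a_2$ are not $(m,\sigma)$-equivalent and not $(m,\sigma)$-isometric.
   Context: $\mathbb{F}_{q^n}[t;\sigma]$ is the twisted polynomial ring with $tc=\sigma(c)t$ for $c\in\mathbb{F}_{q^n}$. The Petit algebra $\mathbb{F}_{q^n}[t;\sigma]/\mathbb{F}_{q^n}[t;\sigma](t^m-a)$ is the $\mathbb{F}_q$-vector space of polynomials of degree $<m$ with product $g\circ h$ equal to the remainder $r$ in the right division $gh=q'(t^m-a)+r$, $\deg r<m$. Put $A_i=\mathbb{F}_{q^n}[t;\sigma_i]/\mathbb{F}_{q^n}[t;\sigma_i](t^m-a_i)$ for $i=1,2$. The Hamming distance of two polynomials of degree $<m$ is the number of indices $0\leq i\leq m-1$ at which their coefficients of $t^i$ differ. Then $a_1$ and $a_2$ are called $(m,\sigma)$-isometric if there exists an isomorphism of nonassociative ($\mathbb{F}_q$-)algebras $A_1\to A_2$ that preserves the Hamming distance. They are called $(m,\sigma)$-equivalent if there exists $\alpha\in\mathbb{F}_q^\times$ such that the map $\varphi_\alpha:A_1\to A_2$, $h(t)\mapsto h(\alpha t)$, is an isomorphism of nonassociative algebras. *)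

(* Defs.v *)
From HB Require Import structures.
From mathcomp Require Import all_boot all_order all_algebra all_fingroup.
From mathcomp Require Import all_solvable all_field.
From mathcomp Require Import zify.

Set Implicit Arguments.
Unset Strict Implicit.
Unset Printing Implicit Defensive.

Import GRing.Theory.
Local Open Scope ring_scope.

(* The twisted polynomial ring L[t; s], with t c = s(c) t.  Its elements are  *)
(* written with coefficients on the left, so it has the same additive group   *)
(* as {poly L}, 'X^i standing for t^i; only the product differs.              *)
Definition tpoly (L : fieldType) (s : {rmorphism L -> L}) : Type := {poly L}.

Section TwistedPoly.
Variables (L : fieldType) (s : {rmorphism L -> L}).
Implicit Types p q r : {poly L}.

HB.instance Definition _ := GRing.Zmodule.on (tpoly s).

Definition tmul p q : {poly L} :=
  \poly_(k < size p + size q) \sum_(i < k.+1) p`_i * iter i s q`_(k - i).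

Definition tone : {poly L} := 1.

Lemma iter_s0 i : iter i s 0 = 0.
Proof. by elim: i => //= i ->; rewrite rmorph0. Qed.

Lemma iter_s1 i : iter i s 1 = 1.
Proof. by elim: i => //= i ->; rewrite rmorph1. Qed.

Lemma iter_sD i : {morph iter i s : x y / x + y}.
Proof. by move=> x y; elim: i => //= i ->; rewrite rmorphD. Qed.

Lemma iter_sM i : {morph iter i s : x y / x * y}.
Proof. by move=> x y; elim: i => //= i ->; rewrite rmorphM. Qed.

Lemma iter_s_sum i n (f : 'I_n -> L) (P : pred 'I_n) :
  iter i s (\sum_(j < n | P j) f j) = \sum_(j < n | P j) iter i s (f j).
Proof. exact: (big_morph _ (iter_sD i) (iter_s0 i)). Qed.

Lemma iter_s_eq0 i x : (iter i s x == 0) = (x == 0).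
Proof. by elim: i => //= i IH; rewrite fmorph_eq0. Qed.

Lemma coef_tmul p q k :
  (tmul p q)`_k = \sum_(i < k.+1) p`_i * iter i s q`_(k - i).
Proof.
rewrite coef_poly; case: ltnP => // le_k; rewrite big1 // => i _.
case: (leqP (size p) i) => [pi|ip]; first by rewrite nth_default ?mul0r.
rewrite [q`_ _]nth_default ?iter_s0 ?mulr0 //.
rewrite leq_subRL -1?ltnS //; apply: leq_trans le_k.
by rewrite leq_add2r ltnW.
Qed.

Lemma coef_tmul_rev p q k :
  (tmul p q)`_k = \sum_(i < k.+1) p`_(k - i) * iter (k - i) s q`_i.
Proof.
rewrite coef_tmul (reindex_inj rev_ord_inj) /=; apply: eq_bigr => i _.
by rewrite subSS subKn // -ltnS.
Qed.

Fact tmulA : associative tmul.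
Proof.
move=> p q r; apply/polyP => i; rewrite coef_tmul coef_tmul_rev.
pose coef3 j k := p`_j * (iter j s q`_(i - j - k) * iter (i - k) s r`_k).
transitivity (\sum_(j < i.+1) \sum_(k < i.+1 | (k <= i - j)%N) coef3 j k).
  apply: eq_bigr => /= j _; rewrite coef_tmul_rev iter_s_sum big_distrr /=.
  rewrite (big_ord_narrow_leq (leq_subr _ _)) /=; apply: eq_bigr => k _.
  rewrite iter_sM -iterD /coef3; congr (_ * (_ * iter _ _ _)).
  by have := ltn_ord k; have := ltn_ord j; lia.
rewrite (exchange_big_dep predT) //=; apply: eq_bigr => k _.
transitivity (\sum_(j < i.+1 | (j <= i - k)%N) coef3 j k).
  apply: eq_bigl => j; rewrite -ltnS -(ltnS j) -!subSn ?leq_ord //.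
  by rewrite -subn_gt0 -(subn_gt0 j) -!subnDA addnC.
rewrite (big_ord_narrow_leq (leq_subr _ _)) coef_tmul big_distrl /=.
by apply: eq_bigr => j _; rewrite /coef3 -!subnDA addnC mulrA.
Qed.

Fact tmul1p : left_id tone tmul.
Proof.
move=> p; apply/polyP => k; rewrite coef_tmul big_ord_recl /= coef1 mul1r subn0.
by rewrite big1 ?addr0 // => i _; rewrite coef1 mul0r.
Qed.

Fact tmulp1 : right_id tone tmul.
Proof.
move=> p; apply/polyP => k; rewrite coef_tmul_rev big_ord_recl /= coef1 subn0.
rewrite iter_s1 mulr1 big1 ?addr0 // => i _.
by rewrite coef1 iter_s0 mulr0.
Qed.

Fact tmulDl : left_distributive tmul +%R.
Proof.
move=> p q r; apply/polyP => k; rewrite coefD !coef_tmul -big_split.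
by apply: eq_bigr => i _; rewrite coefD mulrDl.
Qed.

Fact tmulDr : right_distributive tmul +%R.
Proof.
move=> p q r; apply/polyP => k; rewrite coefD !coef_tmul -big_split.
by apply: eq_bigr => i _; rewrite coefD iter_sD mulrDr.
Qed.

Fact tone_neq0 : tone != 0 :> tpoly s.
Proof. exact: oner_neq0. Qed.

HB.instance Definition _ := GRing.Zmodule_isNzRing.Build (tpoly s)
  tmulA tmul1p tmulp1 tmulDl tmulDr tone_neq0.

(* These casts fix which of the two products a formula uses. *)
Definition tval (p : tpoly s) : {poly L} := p.
Definition tpoly_of (p : {poly L}) : tpoly s := p.

Definition tpolyX : tpoly s := tpoly_of 'X.
Definition tpolyC (c : L) : tpoly s := tpoly_of c%:P.

Lemma tvalM (f g : tpoly s) : tval (f * g) = tmul (tval f) (tval g).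
Proof. by []. Qed.

Lemma tvalD (f g : tpoly s) : tval (f + g) = tval f + tval g.
Proof. by []. Qed.

Lemma tvalB (f g : tpoly s) : tval (f - g) = tval f - tval g.
Proof. by []. Qed.

Lemma coef_CXn c d k : (c *: 'X^d : {poly L})`_k = if k == d then c else 0.
Proof. by rewrite coefZ coefXn; case: eqP; rewrite ?mulr1 ?mulr0. Qed.

Lemma tmul_CXn c d q k :
  (tmul (c *: 'X^d) q)`_k = if (d <= k)%N then c * iter d s q`_(k - d) else 0.
Proof.
rewrite coef_tmul; case: leqP => [le_dk|lt_kd].
  have lt_d : (d < k.+1)%N by [].
  rewrite (bigD1 (Ordinal lt_d)) //= coef_CXn eqxx big1 ?addr0 // => i ne.
  by rewrite coef_CXn ifN ?mul0r.
rewrite big1 // => i _; rewrite coef_CXn ifN ?mul0r // neq_ltn.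
by rewrite (leq_trans (ltn_ord i) _).
Qed.

Lemma tpolyCM c (q : tpoly s) : tval (tpolyC c * q) = c *: tval q.
Proof.
rewrite tvalM (_ : tval (tpolyC c) = c *: 'X^0); last first.
  by rewrite expr0 alg_polyC.
by apply/polyP => k; rewrite tmul_CXn coefZ subn0.
Qed.

Lemma tpolyXM (q : tpoly s) k :
  (tval (tpolyX * q))`_k = if k is k'.+1 then s (tval q)`_k' else 0.
Proof.
rewrite tvalM (_ : tval tpolyX = 1 *: 'X^1); last by rewrite scale1r expr1.
by rewrite tmul_CXn mul1r; case: k => //= k; rewrite subn1.
Qed.

Lemma tpolyX_C c : tpolyX * tpolyC c = tpolyC (s c) * tpolyX.
Proof.
rewrite -[LHS]/(tval _) -[RHS]/(tval _); apply/polyP => k.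
rewrite tpolyXM tpolyCM coefZ coefX.
by case: k => [|[|k]]; rewrite ?coefC /= ?rmorph0 ?mulr0 ?mulr1.
Qed.

Lemma tpolyXn d : tval (tpolyX ^+ d) = 'X^d.
Proof.
elim: d => // d IH; rewrite exprS; apply/polyP => k.
rewrite tpolyXM IH; case: k => [|k]; first by rewrite coefXn.
by rewrite !coefXn eqSS rmorph_nat.
Qed.

Lemma tCXn c d : tval (tpolyC c * tpolyX ^+ d) = c *: 'X^d.
Proof. by rewrite tpolyCM tpolyXn. Qed.

Lemma tpolyE (p : tpoly s) :
  p = \sum_(i < size (tval p)) tpolyC (tval p)`_i * tpolyX ^+ i.
Proof.
rewrite -[LHS](coefK (tval p)) poly_def.
by apply: eq_bigr => i _; rewrite -[RHS]/(tval _) tCXn.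
Qed.

(* Right division: trem f g is the remainder of f modulo the left ideal of   *)
(* multiples q' * g.  One step cancels the leading term of f by means of     *)
(* c t^d g, whose leading coefficient is c s^d(lead_coef g).                 *)
Definition trem_step (g f : tpoly s) : tpoly s :=
  let d := (size (tval f) - size (tval g))%N in
  if (size (tval f) < size (tval g))%N then f else
  f - tpolyC (lead_coef (tval f) / iter d s (lead_coef (tval g)))
      * tpolyX ^+ d * g.

Definition trem (f g : tpoly s) : tpoly s :=
  iter (size (tval f)) (trem_step g) f.

Lemma trem_step_mul (g f : tpoly s) :
  exists q' : tpoly s, f = q' * g + trem_step g f.
Proof.
rewrite /trem_step; case: ifP => _; first by exists 0; rewrite mul0r add0r.
by set c := _ * _ ^+ _; exists c; rewrite [RHS]addrC subrK.
Qed.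

Lemma trem_step_size (g f : tpoly s) :
  g != 0 -> (size (tval g) <= size (tval f))%N ->
  (size (tval (trem_step g f)) < size (tval f))%N.
Proof.
move=> g0 le_gf; rewrite /trem_step ifN -?leqNgt //=.
have sg : (0 < size (tval g))%N by rewrite size_poly_gt0.
have sf : (0 < size (tval f))%N by apply: leq_trans le_gf.
set d := (_ - _)%N; set c := _ / _.
pose n : nat := size (tval f); pose n' : nat := size (tval g).
have [dE fE gE] : [/\ d = (n - n')%N, size (tval f) = n & size (tval g) = n'].
  by [].
move: (le_gf) (sg) (sf); rewrite fE gE => le_gf' sg' sf'.
rewrite -[n in ltnRHS](prednK sf') ltnS; apply/leq_sizeP => k le_k.
rewrite tvalB tvalM tCXn coefB tmul_CXn.
have -> : (d <= k)%N by rewrite dE ?gE; lia.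
have [->|ne_k] := eqVneq k n.-1.
  rewrite (_ : (_ - d)%N = n'.-1); last by rewrite dE ?gE; lia.
  rewrite -fE -gE -!lead_coefE /c mulrVK ?subrr // unitfE iter_s_eq0.
  by rewrite lead_coef_eq0.
have lt_k : (n <= k)%N by lia.
by rewrite !nth_default ?iter_s0 ?mulr0 ?subrr // ?fE ?gE; lia.
Qed.

Lemma trem_mul (f g : tpoly s) : exists q' : tpoly s, f = q' * g + trem f g.
Proof.
rewrite /trem; elim: (size _) => [|k [q' E]] /=.
  by exists 0; rewrite mul0r add0r.
have [q2 E2] := trem_step_mul g (iter k (trem_step g) f).
by exists (q' + q2); rewrite mulrDl -addrA -E2.
Qed.

Lemma trem_size (f g : tpoly s) :
  g != 0 -> (size (tval (trem f g)) < size (tval g))%N.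
Proof.
move=> g0; have sg : (0 < size (tval g))%N by rewrite size_poly_gt0.
have stab k : forall h : tpoly s, (size (tval h) < size (tval g))%N ->
    iter k (trem_step g) h = h.
  by move=> h lt_hg; elim: k => //= k ->; rewrite /trem_step lt_hg.
suff main n h : (size (tval h) <= n)%N ->
    (size (tval (iter n (trem_step g) h)) < size (tval g))%N by apply: main.
elim: n h => [|n IH] h le_h; first exact: leq_ltn_trans le_h sg.
rewrite iterSr; case: (ltnP (size (tval h)) (size (tval g))) => [lt|le].
  by rewrite [trem_step g h](stab 1%N) ?stab.
by apply: IH; rewrite -ltnS; apply: leq_trans le_h; apply: trem_step_size.
Qed.

Lemma size_tmul_lt (q g : tpoly s) :
  (size (tval (q * g)%R) < size (tval g))%N -> q = 0.
Proof.
move=> lt; apply/eqP/negPn/negP => q0.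
have sq : (0 < size (tval q))%N by rewrite size_poly_gt0.
have sg : (0 < size (tval g))%N by apply: leq_ltn_trans lt.
case Eq: (size (tval q)) sq => [|dq] // _; case Eg: (size (tval g)) sg => [|dg] // _.
have: (tval (q * g))`_(dq + dg) = 0.
  by rewrite nth_default // -ltnS (leq_trans lt) // Eg ltnS leq_addl.
have lt_d : (dq < (dq + dg).+1)%N by lia.
rewrite tvalM coef_tmul (bigD1 (Ordinal lt_d)) //= big1 ?addr0; last first.
  move=> i /eqP ne; case: (ltnP i dq) => [lt_i|le_i].
    by rewrite [(tval g)`__]nth_default ?iter_s0 ?mulr0 // Eg; lia.
  rewrite nth_default ?mul0r // Eq.
  have: (i : nat) <> dq by move=> E; apply: ne; apply: val_inj.
  by move: le_i; lia.
have [lq lg] : lead_coef (tval q) = (tval q)`_dq /\ lead_coef (tval g) = (tval g)`_dg.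
  by rewrite !lead_coefE Eq Eg.
rewrite addKn -lq -lg => /eqP; rewrite mulf_eq0 iter_s_eq0 !lead_coef_eq0.
by rewrite -!size_poly_eq0 Eq Eg.
Qed.

Lemma tremP (f g q' r : tpoly s) :
  f = q' * g + r -> (size (tval r) < size (tval g))%N -> trem f g = r.
Proof.
move=> Ef lt_r; have g0 : g != 0.
  have: (0 < size (tval g))%N by apply: leq_ltn_trans lt_r.
  by rewrite size_poly_gt0.
have [q2 E2] := trem_mul f g; have lt2 := trem_size f g0.
have Ed : (q' - q2) * g = trem f g - r.
  apply/eqP; rewrite mulrBl subr_eq addrAC eq_sym subr_eq [_ + q2 * g]addrC.
  by rewrite -E2 Ef.
have /size_tmul_lt/eqP : (size (tval ((q' - q2) * g)%R) < size (tval g))%N.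
  rewrite Ed tvalB; apply: leq_ltn_trans (size_polyD _ _) _.
  by rewrite size_polyN gtn_max lt2.
rewrite subr_eq0 => /eqP Eq; apply/eqP; rewrite -subr_eq0 -Ed Eq subrr.
by rewrite mul0r.
Qed.

End TwistedPoly.

(* The carrier of L[t; s] / L[t; s](t^m - a): polynomials of degree < m. *)
Definition petit (F : fieldType) (L : fieldExtType F)
  (s : {rmorphism L -> L}) (m : nat) (a : L) : Type := {poly_m L}.

Section Petit.
Variables (F : fieldType) (L : fieldExtType F) (s : {rmorphism L -> L}).
Variables (m : nat) (a : L).

HB.instance Definition _ := GRing.Zmodule.on (petit s m a).

Definition petit_scale (c : F) (g : petit s m a) : petit s m a :=
  c%:A *: (g : {poly_m L}).

Fact petit_scaleA c d g :
  petit_scale c (petit_scale d g) = petit_scale (c * d) g.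
Proof. by rewrite /petit_scale scalerA -scalerAl mul1r scalerA. Qed.

Fact petit_scale1 : left_id 1 petit_scale.
Proof. by move=> g; rewrite /petit_scale !scale1r. Qed.

Fact petit_scaleDr : right_distributive petit_scale +%R.
Proof. by move=> c g h; rewrite /petit_scale scalerDr. Qed.

Fact petit_scaleDl g : {morph petit_scale^~ g : c d / c + d}.
Proof. by move=> c d; rewrite /petit_scale !scalerDl. Qed.

HB.instance Definition _ := GRing.Zmodule_isLmodule.Build F (petit s m a)
  petit_scaleA petit_scale1 petit_scaleDr petit_scaleDl.

Definition petit_modulus : tpoly s := tpolyX s ^+ m - tpolyC s a.

Definition petit_mul (g h : petit s m a) : petit s m a :=
  npolyp m (tval (trem (tpoly_of s g * tpoly_of s h) petit_modulus)).

Lemma size_petit_modulus : (0 < m)%N -> size (tval petit_modulus) = m.+1.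
Proof. by move=> m0; rewrite tvalB tpolyXn size_XnsubC. Qed.

(* npolyp does not truncate anything. *)
Lemma petit_mulE (g h : petit s m a) : (0 < m)%N ->
  polyn (petit_mul g h) =
    tval (trem (tpoly_of s g * tpoly_of s h) petit_modulus).
Proof.
move=> m0; rewrite npolypK // -ltnS -size_petit_modulus //.
apply: trem_size; have: (0 < size (tval petit_modulus))%N.
  by rewrite size_petit_modulus.
by rewrite size_poly_gt0.
Qed.

End Petit.

Section Isometry.
Variables (F : fieldType) (L : fieldExtType F) (s1 s2 : {rmorphism L -> L}).
Variables (m : nat) (a1 a2 : L).

Definition petit_isom (f : petit s1 m a1 -> petit s2 m a2) : Prop :=
  [/\ linear f, bijective f &
      forall g h, f (petit_mul g h) = petit_mul (f g) (f h)].

Definition hamming_dist (g h : {poly_m L}) : nat :=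
  #|[set i : 'I_m | g`_i != h`_i]|.

Definition isometric : Prop :=
  exists2 f : petit s1 m a1 -> petit s2 m a2,
    petit_isom f & forall g h, hamming_dist (f g) (f h) = hamming_dist g h.

(* h(t) |-> h(alpha t), the substitution being made in L[t; s2]. *)
Definition petit_subst (alpha : F) (h : petit s1 m a1) : petit s2 m a2 :=
  npolyp m (tval (\sum_(i < m)
    tpolyC s2 h`_i * (tpolyC s2 alpha%:A * tpolyX s2) ^+ i)).

Definition equivalent : Prop :=
  exists2 alpha : F, alpha != 0 & petit_isom (petit_subst alpha).

(* h(alpha t) = sum_i h_i alpha^i t^i as soon as s2 fixes F. *)
Lemma coef_petit_subst (alpha : F) (h : petit s1 m a1) (i : nat) :
  s2 alpha%:A = alpha%:A ->
  (petit_subst alpha h)`_i = h`_i * alpha%:A ^+ i.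
Proof.
move=> fix_alpha; have powE k : (tpolyC s2 alpha%:A * tpolyX s2) ^+ k =
    tpolyC s2 (alpha%:A ^+ k) * tpolyX s2 ^+ k.
  rewrite exprMn_comm; last by rewrite /GRing.comm tpolyX_C fix_alpha.
  congr (_ * _); elim: k => // k IH; rewrite !exprS IH.
  by rewrite -[LHS]/(tval _) tpolyCM -mul_polyC -polyCM.
rewrite coef_npolyp; case: ltnP => [lt_im|le_mi]; last first.
  by rewrite [h`__]nth_default ?mul0r // (leq_trans (size_npoly _)).
have tvalE: forall k, tval (tpolyC s2 h`_k *
    (tpolyC s2 alpha%:A * tpolyX s2) ^+ k) = (h`_k * alpha%:A ^+ k) *: 'X^k.
  by move=> k; rewrite powE tpolyCM tCXn scalerA.
have -> : tval (\sum_(k < m) tpolyC s2 h`_k *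
    (tpolyC s2 alpha%:A * tpolyX s2) ^+ k) =
    \poly_(k < m) (h`_k * alpha%:A ^+ k).
  by rewrite poly_def; apply: eq_bigr => k _; rewrite -tvalE.
by rewrite coef_poly lt_im.
Qed.

End Isometry.

(* Main.v *)
Require Import Defs.
From HB Require Import structures.
From mathcomp Require Import all_boot all_order all_algebra all_fingroup.
From mathcomp Require Import all_solvable all_field.
From mathcomp Require Import zify.

(** Both relations are excluded by one rigidity statement.  Let f be an
isomorphism A_1 -> A_2 preserving the Hamming distance, where A_i is built from
s_i and a_i.  Since f 0 = 0, it preserves weights and so sends monomials to
monomials.  It fixes 1, and a constant c cannot go to a monomial of positive
degree, which would be at distance 2 from 1 while c is at distance at most 1;
hence f restricts to an injective multiplicative map tau of the field L.

If f (t^i) = e t^p, applying f to the rule t^i c = s1^i(c) t^i gives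
s2^p o tau = tau o s1^i ([hamming_isom_iter_eq]).  Over a finite field s2 is a
power map, so it commutes with tau, and s1^i = s2^p.  In particular, writing
f t = b t^k, we get s1 = s2^k.  If k = 1 then s1 = s2, and if k = 0 then s1 is
the identity.

If k >= 2, then f (t^i) = c_i t^(ik) as long as ik < m, with
c_i = b s1(b) ... s1^(i-1)(b).  Let J be the least integer with Jk >= m, which
is less than m because k >= 2, and put r = Jk - m.  At this point the reduction
t^m = a_2 enters: f (t^J) = c_J s2^r(a2) t^r, whence also s1^J = s2^r.  But t
and t^J commute in A_1 (both products are t^(J+1), or a_1 when J + 1 = m), so
their images commute.  The factors c_J satisfy b s1(c_J) = c_J s1^J(b) and
cancel, which leaves s1 (s2^r(a2)) = s2^r(a2), hence s1(a2) = a2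
([isometric_eq_or_fix]).

So s1 and s2 are equal or s1 fixes a2.  As s1 generates the Galois group, the
second case puts a2 in the ground field.  An equivalence only scales the
coefficients by nonzero elements of the ground field, so it is an isometry
([equivalent_isometric]). *)

Set Implicit Arguments.
Unset Strict Implicit.
Unset Printing Implicit Defensive.

Import GRing.Theory.
Local Open Scope ring_scope.

(** * Monomials in a Petit algebra *)

Section Monomials.
Variables (F : fieldType) (L : fieldExtType F) (s : {rmorphism L -> L}).
Variables (m : nat) (a : L).

Definition petit_mono (x : L) (i : nat) : petit s m a := npolyp m (x *: 'X^i).

Lemma coef_petit_mono x i j : (i < m)%N ->
  (petit_mono x i)`_j = if j == i then x else 0.
Proof.
move=> lt_im; rewrite coef_npolyp coef_CXn.
by case: eqP => [->|]; rewrite ?lt_im // if_same.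
Qed.

Lemma petit_ext (g h : petit s m a) :
  (forall i, (i < m)%N -> g`_i = h`_i) -> g = h.
Proof.
move=> E; apply/(@npolyP _ m g h) => i; case: (ltnP i m) => [/E //|le_mi].
by rewrite !big_coef_npoly.
Qed.

Lemma petit_mono_inj i : (i < m)%N -> injective (petit_mono^~ i).
Proof.
move=> lt_im x y /(congr1 (fun g : petit s m a => g`_i)).
by rewrite !coef_petit_mono // eqxx.
Qed.

Lemma polyn_petit_mono x i : (i < m)%N ->
  polyn (petit_mono x i) = x *: 'X^i.
Proof.
move=> lt_im; apply: npolypK; apply: leq_trans (size_scale_leq _ _) _.
by rewrite size_polyXn.
Qed.

Lemma tmul_mono x i y j :
  tmul s (x *: 'X^i) (y *: 'X^j) = (x * iter i s y) *: 'X^(i + j).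
Proof.
apply/polyP => k; rewrite tmul_CXn !coef_CXn; case: leqP => le_ik.
  rewrite -(eqn_add2l i) subnKC //.
  by case: eqP => // _; rewrite iter_s0 mulr0.
by rewrite ifN // neq_ltn (leq_trans le_ik) ?leq_addr.
Qed.

Lemma petit_mul_mono_lt x i y j : (i + j < m)%N ->
  petit_mul (petit_mono x i) (petit_mono y j) =
  petit_mono (x * iter i s y) (i + j).
Proof.
move=> lt; have m0 : (0 < m)%N by lia.
rewrite /petit_mul /petit_mono; congr npolyp.
apply: (@tremP _ _ _ _ 0); last first.
  rewrite size_petit_modulus // ltnS.
  by apply: leq_trans (size_scale_leq _ _) _; rewrite size_polyXn.
rewrite mul0r add0r -[LHS]/(tmul s _ _) !npolypK ?tmul_mono //.
  by apply: leq_trans (size_scale_leq _ _) _; rewrite size_polyXn; lia.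
by apply: leq_trans (size_scale_leq _ _) _; rewrite size_polyXn; lia.
Qed.

Lemma tmul_mono_modulus c r :
  tmul s (c *: 'X^r) (Defs.tval (petit_modulus s m a)) =
  c *: 'X^(m + r) - (c * iter r s a) *: 'X^r.
Proof.
have := mulrBr (tpoly_of s (c *: 'X^r)) (tpolyX s ^+ m) (tpolyC s a).
move/(congr1 (@Defs.tval _ s)); rewrite tvalB !tvalM tpolyXn => ->.
rewrite -[in LHS](scale1r 'X^m) -[Defs.tval (tpolyC s a)](alg_polyC a).
by rewrite -(expr0 'X) !tmul_mono iter_s1 mulr1 addn0 addnC.
Qed.

(** A product of monomials of degree m + r with r < m is reduced by a single
multiple c t^r (t^m - a) of the modulus; moving a through t^r is what produces
the factor s^r(a). *)
Lemma petit_mul_mono_wrap x i y j r : (i < m)%N -> (j < m)%N ->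
  (i + j = m + r)%N ->
  petit_mul (petit_mono x i) (petit_mono y j) =
  petit_mono (x * iter i s y * iter r s a) r.
Proof.
move=> lt_im lt_jm Er; have m0 : (0 < m)%N by lia.
rewrite /petit_mul {3}/petit_mono; congr npolyp; set c := x * iter i s y.
apply: (@tremP _ _ _ _ (tpoly_of s (c *: 'X^r))); last first.
  rewrite size_petit_modulus // ltnS.
  by apply: leq_trans (size_scale_leq _ _) _; rewrite size_polyXn; lia.
rewrite -[LHS]/(tmul s _ _) -[RHS]/(tmul s _ _ + _) tmul_mono_modulus subrK.
by rewrite !polyn_petit_mono // tmul_mono Er.
Qed.

Lemma petit_mulg1 (g : petit s m a) : (0 < m)%N ->
  petit_mul g (petit_mono 1 0) = g.
Proof.
move=> m0; have trem1 : trem (tpoly_of s g * 1) (petit_modulus s m a) = polyn g.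
  apply: (@tremP _ _ _ _ 0); first by rewrite mul0r add0r mulr1.
  by rewrite size_petit_modulus // ltnS size_npoly.
apply: petit_ext => i _.
by rewrite petit_mulE // polyn_petit_mono // expr0 scale1r [trem _ _]trem1.
Qed.

Lemma petit_mul1g (g : petit s m a) : (0 < m)%N ->
  petit_mul (petit_mono 1 0) g = g.
Proof.
move=> m0; have trem1 : trem (1 * tpoly_of s g) (petit_modulus s m a) = polyn g.
  apply: (@tremP _ _ _ _ 0); first by rewrite mul0r add0r mul1r.
  by rewrite size_petit_modulus // ltnS size_npoly.
apply: petit_ext => i _.
by rewrite petit_mulE // polyn_petit_mono // expr0 scale1r [trem _ _]trem1.
Qed.

(** * Hamming weight of monomials *)

Lemma hamming_mono0 x i : (i < m)%N -> x != 0 ->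
  hamming_dist (petit_mono x i) 0 = 1%N.
Proof.
move=> lt_im x0; rewrite /hamming_dist -(cards1 (Ordinal lt_im)).
apply: eq_card => j; rewrite !inE coef_petit_mono // coef0 -val_eqE /=.
by case: (j =P i :> nat); rewrite ?eqxx ?x0.
Qed.

Lemma weight1_mono (g : petit s m a) : hamming_dist g 0 = 1%N ->
  exists x i, [/\ (i < m)%N, x != 0 & g = petit_mono x i].
Proof.
move/eqP/cards1P => [i Ei]; exists g`_i, i; split=> //.
  by have := set11 i; rewrite -Ei inE coef0.
apply: petit_ext => j lt_jm; rewrite coef_petit_mono //.
have := in_set1 (Ordinal lt_jm) i; rewrite -Ei inE coef0 -val_eqE /=.
by case: (j =P i :> nat) => [->|_ /negbFE/eqP].
Qed.

Lemma hamming_mono_le1 x y i : (i < m)%N ->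
  (hamming_dist (petit_mono x i) (petit_mono y i) <= 1)%N.
Proof.
move=> lt_im; rewrite /hamming_dist -(cards1 (Ordinal lt_im)).
apply/subset_leq_card/subsetP => j; rewrite !inE !coef_petit_mono //.
by rewrite -val_eqE /=; case: (j =P i :> nat); rewrite ?eqxx.
Qed.

Lemma hamming_mono_neq x i y j : (i < m)%N -> (j < m)%N -> x != 0 -> y != 0 ->
  i != j -> hamming_dist (petit_mono x i) (petit_mono y j) = 2%N.
Proof.
move=> lt_im lt_jm x0 y0 ne.
transitivity #|[set Ordinal lt_im; Ordinal lt_jm]|; last first.
  by rewrite cards2 -val_eqE /= ne.
apply: eq_card => k; rewrite !inE !coef_petit_mono // -!val_eqE /=.
have [->|_] := eqVneq (k : nat) i; first by rewrite (negPf ne) x0.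
by case: (k =P j :> nat); rewrite ?eqxx // eq_sym.
Qed.

Lemma petit_mul_const x y : (0 < m)%N ->
  petit_mul (petit_mono x 0) (petit_mono y 0) = petit_mono (x * y) 0.
Proof. by move=> m0; rewrite petit_mul_mono_lt. Qed.

End Monomials.

(** * Isomorphisms preserving the Hamming distance *)

Section HammingIsomorphism.
Variables (F : fieldType) (L : fieldExtType F) (s1 s2 : {rmorphism L -> L}).
Variables (m : nat) (a1 a2 : L) (f : petit s1 m a1 -> petit s2 m a2).
Hypothesis f_isom : petit_isom f.
Hypothesis f_isometry :
  forall g h, hamming_dist (f g) (f h) = hamming_dist g h.

Local Notation M1 := (petit_mono s1 m a1).
Local Notation M2 := (petit_mono s2 m a2).

Lemma petit_isom0 : f 0 = 0.
Proof.
have [flin _ _] := f_isom.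
have := flin 1 0 0; rewrite !scale1r addr0 => /eqP.
by rewrite -subr_eq subrr eq_sym => /eqP.
Qed.

Lemma petit_isom1 : (0 < m)%N -> f (M1 1 0) = M2 1 0.
Proof.
have [_ [g _ gK] fM] := f_isom => m0.
have := fM (g (M2 1 0)) (M1 1 0).
by rewrite gK petit_mulg1 // petit_mul1g // gK.
Qed.

Lemma hamming_isom_mono x i : (i < m)%N -> x != 0 ->
  exists y k, [/\ (k < m)%N, y != 0 & f (M1 x i) = M2 y k].
Proof.
move=> lt x0; apply: weight1_mono.
by rewrite -petit_isom0 f_isometry hamming_mono0.
Qed.

(** The restriction to constants is compared with f 1 = 1: the distance from 1
to a constant is at most 1, which forbids a monomial of positive degree as an
image. *)
Lemma hamming_isom_const : (0 < m)%N ->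
  exists2 tau : L -> L, forall x, f (M1 x 0) = M2 (tau x) 0
    & [/\ injective tau, tau 1 = 1 & forall x y, tau (x * y) = tau x * tau y].
Proof.
move=> m0; have [_ fbij fM] := f_isom.
have f1 := petit_isom1 m0.
have [tau fC] : exists tau, forall x, f (M1 x 0) = M2 (tau x) 0.
  exists (fun x => (f (M1 x 0))`_0) => x; have [->|x0] := eqVneq x 0.
    have M10 : M1 0 0 = 0.
      by apply: petit_ext => i _; rewrite coef_petit_mono // coef0 if_same.
    rewrite M10 petit_isom0; apply: petit_ext => i _.
    by rewrite coef_petit_mono // !coef0 if_same.
  have [y [k [lt_km y0 Ef]]] := hamming_isom_mono m0 x0; rewrite Ef.
  have [->|k0] := eqVneq k 0; first by rewrite coef_petit_mono.
  have := hamming_mono_le1 s1 a1 x 1 m0; rewrite -f_isometry f1 Ef.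
  by rewrite hamming_mono_neq // oner_neq0.
exists tau => //; split=> [x y E||x y].
- apply: (@petit_mono_inj _ _ s1 m a1 _ m0); apply: (bij_inj fbij).
  by rewrite /= !fC E.
- by apply: (@petit_mono_inj _ _ s2 m a2 _ m0); have := fC 1; rewrite f1.
have := congr1 f (petit_mul_const s1 a1 x y m0).
rewrite fM !fC petit_mul_const // => /(@petit_mono_inj _ _ s2 m a2 _ m0) E.
by rewrite E.
Qed.

(** Applying f to t^i c = s1^i(c) t^i gives tau o s1^i = s2^p o tau on L.  Being
multiplicative, tau commutes with the power map s2, and being injective, it can
then be cancelled. *)
Lemma hamming_isom_iter_eq N i p e : (forall x, s2 x = x ^+ N) ->
  (i < m)%N -> (p < m)%N -> e != 0 ->
  f (M1 1 i) = M2 e p -> iter i s1 =1 iter p s2.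
Proof.
move=> s2N lt_im lt_pm e0 Ef; have m0 : (0 < m)%N by lia.
have [_ _ fM] := f_isom.
have [tau fC [tau_inj tau1 tauM]] := hamming_isom_const m0.
have tauX n y : tau (y ^+ n) = tau y ^+ n.
  by elim: n => [|n IH]; rewrite ?expr0 ?tau1 // !exprS tauM IH.
have tau_s2 n x : tau (iter n s2 x) = iter n s2 (tau x).
  by elim: n => //= n IH; rewrite -IH !s2N tauX.
move=> x; apply: tau_inj; rewrite tau_s2.
have twist :
    petit_mul (M1 1 i) (M1 x 0) = petit_mul (M1 (iter i s1 x) 0) (M1 1 i).
  by rewrite !petit_mul_mono_lt ?addn0 // mul1r mulr1.
move: (congr1 f twist); rewrite !fM Ef !fC.
rewrite !petit_mul_mono_lt ?addn0 //= => /petit_mono_inj E.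
by apply: (mulIf e0); rewrite -E // mulrC.
Qed.

(** Commutation of t and t^j passes to their images b t^k and e t^p; whether or
not the common degree k + p exceeds m, both products reduce in the same way. *)
Lemma petit_isom_comm_t j b k e p : (1 < m)%N -> (j < m)%N ->
  (k < m)%N -> (p < m)%N -> a2 != 0 ->
  f (M1 1 1) = M2 b k -> f (M1 1 j) = M2 e p ->
  b * iter k s2 e = e * iter p s2 b.
Proof.
move=> m1 lt_jm lt_km lt_pm a2n0 Et Ej; have [_ _ fM] := f_isom.
have comm1 : petit_mul (M1 1 1) (M1 1 j) = petit_mul (M1 1 j) (M1 1 1).
  have [lt|le] := ltnP j.+1 m.
    by rewrite !petit_mul_mono_lt ?iter_s1 ?addn1 // addnC.
  by rewrite !(@petit_mul_mono_wrap _ _ _ _ _ _ _ _ _ 0) ?iter_s1 //; lia.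
move: (congr1 f comm1); rewrite !fM Et Ej.
have [lt|le] := ltnP (k + p) m.
  have lt' : (p + k < m)%N by rewrite addnC.
  rewrite (petit_mul_mono_lt _ _ _ _ lt) (petit_mul_mono_lt _ _ _ _ lt').
  by rewrite addnC => /petit_mono_inj; apply.
have [w Ew] : exists w, (k + p = m + w)%N by exists (k + p - m)%N; lia.
have Ew' : (p + k = m + w)%N by rewrite addnC.
have lt_wm : (w < m)%N by lia.
rewrite (petit_mul_mono_wrap _ _ _ _ lt_km lt_pm Ew).
rewrite (petit_mul_mono_wrap _ _ _ _ lt_pm lt_km Ew').
by move/(petit_mono_inj lt_wm); apply: mulIf; rewrite iter_s_eq0.
Qed.

End HammingIsomorphism.

(** The degree k of the image of t decides: k = 0 makes s1 the identity, k = 1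
makes s1 = s2, and for k >= 2 the first power of t whose image wraps around
t^m = a2 carries a conjugate of a2 in its coefficient, which the commutation
with t forces to be fixed by s1. *)
Lemma isometric_eq_or_fix (F : fieldType) (L : fieldExtType F)
    (s1 s2 : {rmorphism L -> L}) (m N : nat) (a1 a2 : L) :
  (1 < m)%N -> (forall x, s2 x = x ^+ N) -> isometric s1 s2 m a1 a2 ->
  s1 =1 s2 \/ s1 a2 = a2.
Proof.
move=> m1 s2N [f f_isom f_isometry]; have [_ _ fM] := f_isom.
have [->|a2n0] := eqVneq a2 0; first by right; rewrite rmorph0.
have m0 : (0 < m)%N by lia.
pose M1 := petit_mono s1 m a1; pose M2 := petit_mono s2 m a2.
have iter_eq i p e := @hamming_isom_iter_eq _ _ _ _ _ _ _ _
  f_isom f_isometry _ i p e s2N.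
have [b [k [lt_km b0 Et]]] :
    exists b k, [/\ (k < m)%N, b != 0 & f (M1 1 1) = M2 b k].
  exact: hamming_isom_mono f_isom f_isometry _ _ m1 (oner_neq0 _).
have s1k : s1 =1 iter k s2 := iter_eq _ _ _ m1 lt_km b0 Et.
have [k0|[k1|k2]] : k = 0%N \/ k = 1%N \/ (1 < k)%N by lia.
- by right; rewrite [LHS]s1k k0.
- by left=> x; rewrite [LHS]s1k k1.
right.
(* Coefficient of the i-th iterate of left multiplication by b t^k on 1, as long
   as no reduction occurs: b t^k moves past it by s2^k = s1. *)
pose c := fix c i := if i is i'.+1 then b * s1 (c i') else 1.
have c0 i : c i != 0.
  by elim: i => [|i IH] /=; rewrite ?oner_neq0 ?mulf_neq0 ?fmorph_eq0.
have cS i : b * s1 (c i) = c i * iter i s1 b.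
  elim: i => [|i IH] /=; first by rewrite rmorph1 mul1r mulr1.
  by rewrite {1}IH rmorphM mulrA.
(* The least exponent whose image wraps is below m, since (m - 1) k >= m. *)
have exm : exists j, (m <= j * k)%N by exists m; nia.
have [j le_m jmin] := ex_minnP exm.
have lt_jm : (j < m)%N.
  have : (m <= m.-1 * k)%N by nia.
  by move/jmin; lia.
case: j => [|j] in le_m jmin lt_jm *; first by lia.
have lt_j : (j * k < m)%N by rewrite ltnNge; apply/negP => /jmin; lia.
have ftS i : (i.+1 < m)%N -> f (M1 1 i.+1) = petit_mul (M2 b k) (f (M1 1 i)).
  by move=> lt; rewrite -Et -fM petit_mul_mono_lt // mul1r iter_s1.
have ftE i : (i < m)%N -> (i * k < m)%N -> f (M1 1 i) = M2 (c i) (i * k).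
  elim: i => [|i IH] lt_im lt_ik; first exact: petit_isom1.
  rewrite ftS // IH; [|lia|lia].
  by rewrite petit_mul_mono_lt -?mulSn // -s1k.
pose r := (j.+1 * k - m)%N; pose D := iter r s2 a2.
have Er : (k + j * k = m + r)%N by rewrite /r; lia.
have lt_rm : (r < m)%N by lia.
have fj : f (M1 1 j.+1) = M2 (c j.+1 * D) r.
  rewrite ftS // ftE //; last by lia.
  by rewrite (petit_mul_mono_wrap _ _ _ _ lt_km lt_j Er) // -s1k.
have e0 : c j.+1 * D != 0 by rewrite mulf_neq0 ?iter_s_eq0.
have s2r := iter_eq _ _ _ lt_jm lt_rm e0 fj.
have fixD : s1 D = D.
  have := petit_isom_comm_t f_isom m1 lt_jm lt_km lt_rm a2n0 Et fj.
  rewrite -s1k -s2r rmorphM mulrA cS => comm2.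
  have nz : c j.+1 * iter j.+1 s1 b != 0 by rewrite mulf_neq0 ?iter_s_eq0.
  by apply: (mulfI nz); rewrite comm2 mulrAC.
(* s1 = s2^k commutes with s2^r, and s2^r is injective. *)
have : iter r s2 (s1 a2) = iter r s2 a2.
  by rewrite -[RHS]/D -[RHS]fixD !s1k /D -!iterD addnC.
move/eqP; rewrite -subr_eq0 => Z.
apply/eqP; rewrite -subr_eq0 -(iter_s_eq0 s2 r).
by rewrite -(subrK a2 (s1 a2)) iter_sD addrK in Z.
Qed.

Lemma equivalent_isometric (F : fieldType) (L : fieldExtType F)
    (s1 s2 : {rmorphism L -> L}) (m : nat) (a1 a2 : L) :
  (forall x : F, s2 x%:A = x%:A) ->
  equivalent s1 s2 m a1 a2 -> isometric s1 s2 m a1 a2.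
Proof.
move=> s2F [al al0 iso]; exists (@petit_subst F L s1 s2 m a1 a2 al) => // g h.
rewrite /hamming_dist; apply: eq_card => i; rewrite !inE !coef_petit_subst //.
congr negb; apply/eqP/eqP => [|-> //]; apply: mulIf.
by rewrite expf_neq0 // -in_algE fmorph_eq0.
Qed.

(** * Galois groups of finite fields *)

Lemma generator_fixed_mem1 (F : finFieldType) (L : splittingFieldType F)
    (s : gal_of {:L}) (x : L) :
  generator 'Gal({:L} / 1) s -> s x = x -> x \in 1%VS.
Proof.
move=> gs sx; have gal1 := finField_galois (sub1v {:L}).
have /galois_fixedField <- := gal1.
apply/fixedFieldP; first exact: memvf.
rewrite (eqP gs) => u /cycleP[i ->].
elim: i => [|i IH]; first by rewrite expg0 gal_id.
by rewrite expgS galM ?memvf // sx IH.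
Qed.

Lemma gal_finField_pow (F : finFieldType) (L : splittingFieldType F)
    (s : gal_of {:L}) : exists N, forall x : L, s x = x ^+ N.
Proof.
have [al gal_al alE] := finField_galois_generator (sub1v {:L}).
have : s \in 'Gal({:L} / 1)%g by rewrite gal_kHom ?sub1v // k1AHom.
rewrite (eqP gal_al) => /cycleP[i ->]; elim: i => [|i [N IH]].
  by exists 1%N => x; rewrite expg0 gal_id expr1.
by exists (#|F| ^ \dim (1%VS : {vspace L}) * N)%N => x;
   rewrite expgS galM ?memvf // IH alE ?memvf // exprM.
Qed.

Theorem theorem6p4 (F : finFieldType) (L : splittingFieldType F) (m n : nat)
    (hm : (1 < m)%N) (hn : (3 <= n)%N) (hmn : (m - 1 <= n)%N)
    (hL : \dim {:L} = n)
    (s1 s2 : gal_of {:L})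
    (hs1 : generator 'Gal({:L} / 1) s1) (hs2 : generator 'Gal({:L} / 1) s2)
    (hs : s1 != s2)
    (a1 a2 : L) (ha1 : a1 \notin 1%VS) (ha2 : a2 \notin 1%VS) :
  ~ equivalent s1 s2 m a1 a2 /\ ~ isometric s1 s2 m a1 a2.
Proof.
have not_iso : ~ isometric s1 s2 m a1 a2.
  have [N s2N] := gal_finField_pow s2.
  case/(isometric_eq_or_fix hm s2N) => [eq_s | fix_a2].
    by move/eqP: hs; apply; apply/eqP/gal_eqP => x _; apply: eq_s.
  by move/negP: ha2; apply; apply: generator_fixed_mem1 hs1 fix_a2.
split=> // eqv; apply: not_iso; apply: equivalent_isometric eqv => x.
exact: rmorph_alg.
Qed.
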